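(* Let $n\ge1$ be an integer and $\nu\in\mathbb R$. Let $(X,Y)$ be two functions of a variable $a$. If they obey the differential system $$a\frac{d}{da}X=\nu X-(1-X^2)\frac{2na}{1-a^2}\,\frac{aX+Y}{1+aXY},$$ $$a\frac{d}{da}Y=-(\nu+1)Y+(1-Y^2)\frac{2na}{1-a^2}\,\frac{X+aY}{1+aXY},$$ then the quantity $q=a\,\frac{aX+Y}{X+aY}$ satisfies, as a function of $b=a^2$, the Painlev\'e VI differential equation $$\frac{d^2q}{db^2}=\frac12\left\{\frac1q+\frac1{q-1}+\frac1{q-b}\right\}\left(\frac{dq}{db}\right)^2-\left\{\frac1b+\frac1{b-1}+\frac1{q-b}\right\}\frac{dq}{db}+\frac{q(q-1)(q-b)}{b^2(b-1)^2}\left\{\alpha+\frac{\beta b}{q^2}+\frac{\gamma(b-1)}{(q-1)^2}+\frac{\delta b(b-1)}{(q-b)^2}\right\}$$ with parameters $$(\alpha,\beta,\gamma,\delta)=\left(\frac{(\nu+n)^2}2,\ \frac{-(\nu+n+1)^2}2,\ \frac{n^2}2,\ \frac{1-n^2}2\right).$$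
   Context: $X$ and $Y$ are differentiable functions of $a$ (for instance for $a$ in an open subinterval of $(0,1)$); the identities are understood at points where the expressions involved are defined, i.e. where the denominators do not vanish. *)

(* Defs.v *)
From Stdlib Require Import Reals.
From Coquelicot Require Import Coquelicot.
Open Scope R_scope.

(* The system is imposed at the points of [D] where its denominators do not
   vanish; [X] and [Y] are differentiable on the whole of [D]. *)
Definition solves_system (n : nat) (nu : R) (D : R -> Prop) (X Y : R -> R) : Prop :=
  forall a : R, D a ->
    ex_derive X a /\ ex_derive Y a /\
    (1 - a ^ 2 <> 0 -> 1 + a * X a * Y a <> 0 ->
      a * Derive X a =
        nu * X a
        - (1 - X a ^ 2) * (2 * INR n * a / (1 - a ^ 2))
          * ((a * X a + Y a) / (1 + a * X a * Y a)) /\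
      a * Derive Y a =
        - (nu + 1) * Y a
        + (1 - Y a ^ 2) * (2 * INR n * a / (1 - a ^ 2))
          * ((X a + a * Y a) / (1 + a * X a * Y a))).

Definition q_of (X Y : R -> R) (a : R) : R :=
  a * ((a * X a + Y a) / (X a + a * Y a)).

Definition PVI_rhs (alpha beta gamma delta b q q' : R) : R :=
  1 / 2 * (1 / q + 1 / (q - 1) + 1 / (q - b)) * q' ^ 2
  - (1 / b + 1 / (b - 1) + 1 / (q - b)) * q'
  + q * (q - 1) * (q - b) / (b ^ 2 * (b - 1) ^ 2)
    * (alpha + beta * b / q ^ 2 + gamma * (b - 1) / (q - 1) ^ 2
       + delta * b * (b - 1) / (q - b) ^ 2).

(* [Derive] is a total operator, so twice differentiability of [Q] at [b] is
   part of the assertion. *)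
Definition satisfies_PVI_at (alpha beta gamma delta : R) (Q : R -> R) (b : R) : Prop :=
  locally b (fun t => ex_derive Q t) /\
  ex_derive (Derive Q) b /\
  Derive (Derive Q) b = PVI_rhs alpha beta gamma delta b (Q b) (Derive Q b).

(* [Q] expresses [q] as a function of [b = a ^ 2] near [a0].  For [a0 <> 0] the
   map [a |-> a ^ 2] is a local homeomorphism at [a0], so this determines the
   germ of [Q] at [a0 ^ 2]; for [a0 > 0] it is that of [fun b => q (sqrt b)]. *)
Definition function_of_square_near (a0 : R) (q Q : R -> R) : Prop :=
  locally a0 (fun a => Q (a ^ 2) = q a).

(* Main.v *)
Require Import Defs.
From Stdlib Require Import Reals Lra.
From Coquelicot Require Import Coquelicot.
Open Scope R_scope.

(** Write [b = a^2], [B = X + aY], [C = 1 + aXY] and [w = 1/C].  The pair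
    [(X, Y)] enters [q] only through [Y/X]; taking [w] as second coordinate
    turns the given system into one that is rational in [(b, q, w)].  The
    dictionary is

      [q - 1 = -(1-b) X / B],   [q - b = (1-b) aY / B],   [w = 1 / C].

    Differentiating [q] and collecting terms leaves only one term in [1/C]:

      [dq/db = (1-q)/(1-b) + (nu+n)(q-1)(q-b)/(b(1-b)) - nq/b + 2nqw/b].

    In the derivative of [C] the linear parts [nu X] and [-(nu+1) Y] contribute
    [-aXY], which cancels against the explicit factor [a], so that
    [a dC/da = (2n a^2/(1-b)) (X^2 - Y^2)].  By the dictionary
    [C - 1 = B^2 (1-q)(q-b)/(1-b)^2], and this eliminates [B] from [X^2 - Y^2]:

      [dw/db = n w(1-w)(q^2-b)/(b(1-q)(q-b))].

    The first equation is affine in [w] with coefficient [2nq/b], so it can be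
    solved for [w]; differentiating it once more, substituting the second one
    and eliminating [w] gives Painleve VI.  The parameters involve [nu] only
    through [m = nu + n], as the system for [(q, w)] does.
    [PVI_of_first_order_system] is this elimination; [is_derive_q_of] and
    [is_derive_w_of] derive the system from the one for [(X, Y)].

    What remains is the change of variable from [a] to [b].  The inverse of
    squaring near [a], with the sign of [a], is [root_branch a]; the function
    [Q] agrees near [a^2] with [q] composed with this branch. *)

Set Bullet Behavior "Strict Subproofs".

Definition w_of (X Y : R -> R) (a : R) : R := / (1 + a * X a * Y a).

(** The right-hand side of the equation for [dq/db], with [m] for [nu + n]. *)
Definition q_field (m n b q w : R) : R :=
  (1 - q) / (1 - b) + m * ((q - 1) * (q - b)) / (b * (1 - b))
  - n * q / b + 2 * n * q * w / b.

Definition w_field (n b q w : R) : R :=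
  n * w * (1 - w) * (q ^ 2 - b) / (b * (1 - q) * (q - b)).

(** The equation for [Q] has to hold on a neighbourhood, because it is
    differentiated once more; that for [W] enters only through its value at [b]. *)
Lemma PVI_of_first_order_system (m n b : R) (Q W : R -> R) :
  b <> 0 -> b <> 1 -> Q b <> 0 -> Q b <> 1 -> Q b <> b ->
  locally b (fun t => is_derive Q t (q_field m n t (Q t) (W t))) ->
  is_derive W b (w_field n b (Q b) (W b)) ->
  satisfies_PVI_at (m ^ 2 / 2) (- (m + 1) ^ 2 / 2) (n ^ 2 / 2)
    ((1 - n ^ 2) / 2) Q b.
Proof.
  intros hb0 hb1 hq0 hq1 hqb HQ HW.
  assert (hb1' : 1 - b <> 0) by lra.
  assert (hb1'' : b - 1 <> 0) by lra.
  assert (hq1' : 1 - Q b <> 0) by lra.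
  assert (hq1'' : Q b - 1 <> 0) by lra.
  assert (hqb' : Q b - b <> 0) by lra.
  assert (HQb := locally_singleton _ _ HQ).
  assert (exQ : ex_derive Q b) by (eexists; exact HQb).
  assert (exW : ex_derive W b) by (eexists; exact HW).
  assert (HQ' : locally b (fun t => q_field m n t (Q t) (W t) = Derive Q t)).
  { revert HQ; apply filter_imp; intros t Ht.
    symmetry; exact (is_derive_unique _ _ _ Ht). }
  assert (eQ : Derive Q b = q_field m n b (Q b) (W b))
    by exact (is_derive_unique _ _ _ HQb).
  assert (eW : Derive W b = w_field n b (Q b) (W b))
    by exact (is_derive_unique _ _ _ HW).
  assert (H2 : is_derive (Derive Q) b
    (PVI_rhs (m ^ 2 / 2) (- (m + 1) ^ 2 / 2) (n ^ 2 / 2) ((1 - n ^ 2) / 2)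
       b (Q b) (Derive Q b))).
  { apply (is_derive_ext_loc _ _ _ _ HQ').
    unfold q_field; auto_derive.
    - repeat split; try assumption;
        try apply Rmult_integral_contrapositive_currified; assumption.
    - (* [auto_derive] leaves eta-expanded functions. *)
      change (Derive (fun t : R => Q t) b) with (Derive Q b).
      change (Derive (fun t : R => W t) b) with (Derive W b).
      rewrite eQ, eW; unfold PVI_rhs, q_field, w_field.
      field; repeat split; assumption. }
  split; [|split].
  - revert HQ; apply filter_imp; intros t Ht; (eexists; exact Ht).
  - (eexists; exact H2).
  - exact (is_derive_unique _ _ _ H2).
Qed.

Lemma q_of_minus_1 (X Y : R -> R) (a : R) :
  X a + a * Y a <> 0 ->
  q_of X Y a - 1 = - (1 - a ^ 2) * X a / (X a + a * Y a).
Proof. intros h; unfold q_of; field; exact h. Qed.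

Lemma q_of_minus_square (X Y : R -> R) (a : R) :
  X a + a * Y a <> 0 ->
  q_of X Y a - a ^ 2 = (1 - a ^ 2) * (a * Y a) / (X a + a * Y a).
Proof. intros h; unfold q_of; field; exact h. Qed.

Lemma Derive_X (n : nat) (nu : R) (D : R -> Prop) (X Y : R -> R) (a : R) :
  solves_system n nu D X Y -> D a ->
  a <> 0 -> 1 - a ^ 2 <> 0 -> 1 + a * X a * Y a <> 0 ->
  Derive X a = (nu * X a
        - (1 - X a ^ 2) * (2 * INR n * a / (1 - a ^ 2))
          * ((a * X a + Y a) / (1 + a * X a * Y a))) / a.
Proof.
  intros hXY ha ha0 ha1 hden; destruct (hXY a ha) as [_ [_ H]].
  rewrite <- (proj1 (H ha1 hden)); field; exact ha0.
Qed.

Lemma Derive_Y (n : nat) (nu : R) (D : R -> Prop) (X Y : R -> R) (a : R) :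
  solves_system n nu D X Y -> D a ->
  a <> 0 -> 1 - a ^ 2 <> 0 -> 1 + a * X a * Y a <> 0 ->
  Derive Y a = (- (nu + 1) * Y a
        + (1 - Y a ^ 2) * (2 * INR n * a / (1 - a ^ 2))
          * ((X a + a * Y a) / (1 + a * X a * Y a))) / a.
Proof.
  intros hXY ha ha0 ha1 hden; destruct (hXY a ha) as [_ [_ H]].
  rewrite <- (proj2 (H ha1 hden)); field; exact ha0.
Qed.

(** The chain-rule factor [2 * a] is [db/da], so the other factor is [dq/db]. *)
Lemma is_derive_q_of (n : nat) (nu : R) (D : R -> Prop) (X Y : R -> R) (a : R) :
  solves_system n nu D X Y -> D a ->
  a <> 0 -> 1 - a ^ 2 <> 0 -> 1 + a * X a * Y a <> 0 ->
  X a + a * Y a <> 0 ->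
  is_derive (q_of X Y) a
    (2 * a * q_field (nu + INR n) (INR n) (a ^ 2) (q_of X Y a) (w_of X Y a)).
Proof.
  intros hXY ha ha0 ha1 hden hqden; destruct (hXY a ha) as [eX [eY _]].
  unfold q_of, w_of; auto_derive.
  - repeat split; assumption.
  - change (Derive (fun x : R => X x) a) with (Derive X a).
    change (Derive (fun x : R => Y x) a) with (Derive Y a).
    rewrite (Derive_X n nu D X Y a),
      (Derive_Y n nu D X Y a) by assumption.
    unfold q_field.
    field; repeat split; assumption.
Qed.

(** The elimination of [X + aY] divides by [(1-q)(q-b)], that is, by [XY] up to
    nonzero factors; [q <> 1] and [q <> b] give [X <> 0] and [Y <> 0]. *)
Lemma is_derive_w_of (n : nat) (nu : R) (D : R -> Prop) (X Y : R -> R) (a : R) :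
  solves_system n nu D X Y -> D a ->
  a <> 0 -> 1 - a ^ 2 <> 0 -> 1 + a * X a * Y a <> 0 ->
  X a + a * Y a <> 0 -> q_of X Y a <> 1 -> q_of X Y a <> a ^ 2 ->
  is_derive (w_of X Y) a
    (2 * a * w_field (INR n) (a ^ 2) (q_of X Y a) (w_of X Y a)).
Proof.
  intros hXY ha ha0 ha1 hden hqden hq1 hqb; destruct (hXY a ha) as [eX [eY _]].
  assert (hX : X a <> 0).
  { intros e; apply hq1, Rminus_diag_uniq.
    rewrite q_of_minus_1 by exact hqden; rewrite e; unfold Rdiv; ring. }
  assert (hY : Y a <> 0).
  { intros e; apply hqb, Rminus_diag_uniq.
    rewrite q_of_minus_square by exact hqden; rewrite e; unfold Rdiv; ring. }
  unfold w_field.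
  (* Factored forms of the denominators let [field] see that they vanish only
     where [X] or [Y] does. *)
  replace (1 - q_of X Y a) with (- (q_of X Y a - 1)) by ring.
  rewrite q_of_minus_1, q_of_minus_square by exact hqden.
  unfold q_of, w_of; auto_derive.
  - repeat split; assumption.
  - change (Derive (fun x : R => X x) a) with (Derive X a).
    change (Derive (fun x : R => Y x) a) with (Derive Y a).
    rewrite (Derive_X n nu D X Y a),
      (Derive_Y n nu D X Y a) by assumption.
    field; repeat split; assumption.
Qed.

(** The solution [s] of [s^2 = t] that has the sign of [a]; dividing by [a ^ 2]
    under the root treats positive and negative [a] alike. *)
Definition root_branch (a t : R) : R := a * sqrt (t / a ^ 2).

Lemma root_branch_at (a : R) : a <> 0 -> root_branch a (a ^ 2) = a.
Proof.
  intros ha; unfold root_branch.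
  replace (a ^ 2 / a ^ 2) with 1 by (field; exact ha).
  rewrite sqrt_1; ring.
Qed.

Lemma root_branch_square (a t : R) : a <> 0 -> 0 < t -> root_branch a t ^ 2 = t.
Proof.
  intros ha ht; unfold root_branch.
  rewrite Rpow_mult_distr, pow2_sqrt.
  - field; exact ha.
  - apply Rlt_le, Rdiv_lt_0_compat; [exact ht | apply pow2_gt_0, ha].
Qed.

Lemma is_derive_root_branch (a t : R) :
  a <> 0 -> 0 < t -> is_derive (root_branch a) t (/ (2 * root_branch a t)).
Proof.
  intros ha ht; unfold root_branch.
  assert (hp : 0 < t / a ^ 2)
    by (apply Rdiv_lt_0_compat; [exact ht | apply pow2_gt_0, ha]).
  assert (hs := sqrt_lt_R0 _ hp).
  auto_derive.
  - exact hp.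
  - change (a * (a * 1)) with (a ^ 2).
    change (t * / a ^ 2) with (t / a ^ 2).
    field; split; lra.
Qed.

Lemma locally_root_branch (a : R) (P : R -> Prop) :
  a <> 0 -> locally a P -> locally (a ^ 2) (fun t => P (root_branch a t)).
Proof.
  intros ha HP.
  assert (Hc : continuous (root_branch a) (a ^ 2)).
  { apply (ex_derive_continuous (root_branch a)).
    eexists; apply is_derive_root_branch; [exact ha | apply pow2_gt_0, ha]. }
  apply Hc; rewrite root_branch_at by exact ha; exact HP.
Qed.

(** Passing to the variable [t = s^2] removes the factor [2 * s = dt/ds]. *)
Lemma is_derive_via_root_branch (a t l : R) (f : R -> R) :
  a <> 0 -> 0 < t ->
  is_derive f (root_branch a t) (2 * root_branch a t * l) ->
  is_derive (fun t => f (root_branch a t)) t l.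
Proof.
  intros ha ht Hf.
  assert (hs : root_branch a t <> 0).
  { intros e; assert (h := root_branch_square a t ha ht); rewrite e in h; lra. }
  evar_last.
  - apply (is_derive_comp f (root_branch a)); [exact Hf |].
    apply is_derive_root_branch; assumption.
  - unfold scal; simpl; unfold mult; simpl; field; exact hs.
Qed.

Lemma locally_neq_0 (f : R -> R) (a : R) :
  continuous f a -> f a <> 0 -> locally a (fun x => f x <> 0).
Proof. intros Hf Ha; exact (Hf (fun u => u <> 0) (open_neq 0 _ Ha)). Qed.

Theorem theorem18 (n : nat) (hn : (1 <= n)%nat) (nu : R)
  (D : R -> Prop) (hD : open D) (X Y : R -> R)
  (hXY : solves_system n nu D X Y)
  (a : R) (ha : D a)
  (ha0 : a <> 0) (ha1 : 1 - a ^ 2 <> 0)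
  (hden : 1 + a * X a * Y a <> 0)
  (hqden : X a + a * Y a <> 0)
  (hq0 : q_of X Y a <> 0) (hq1 : q_of X Y a <> 1) (hqb : q_of X Y a <> a ^ 2)
  (Q : R -> R) (hQ : function_of_square_near a (q_of X Y) Q) :
  satisfies_PVI_at
    ((nu + INR n) ^ 2 / 2)
    (- (nu + INR n + 1) ^ 2 / 2)
    (INR n ^ 2 / 2)
    ((1 - INR n ^ 2) / 2)
    Q (a ^ 2).
Proof.
  assert (hb : 0 < a ^ 2) by (apply pow2_gt_0, ha0).
  destruct (hXY a ha) as [eX [eY _]].
  assert (Hpos : locally (a ^ 2) (fun t => 0 < t)) by (apply (open_gt 0), hb).
  assert (Qa : Q (a ^ 2) = q_of X Y a) by exact (locally_singleton _ _ hQ).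
  assert (HQ : locally (a ^ 2) (fun t => Q t = q_of X Y (root_branch a t))).
  { generalize (filter_and _ _ Hpos (locally_root_branch a _ ha0 hQ)).
    apply filter_imp; intros t [ht e].
    rewrite <- e, root_branch_square by assumption; reflexivity. }
  (* The first-order equation for [q] is needed near [a], so its denominators
     must be nonzero on a neighbourhood; continuity of [X] and [Y] gives this. *)
  assert (Hreg : locally a (fun x => x <> 0 /\ 1 - x ^ 2 <> 0 /\
            1 + x * X x * Y x <> 0 /\ X x + x * Y x <> 0)).
  { repeat apply filter_and;
      (apply locally_neq_0;
       [apply (ex_derive_continuous (V := R_NormedModule)) | assumption]);
      auto_derive; repeat split; assumption. }
  apply (PVI_of_first_order_system _ _ _ Q
    (fun t => w_of X Y (root_branch a t)));
    try rewrite Qa; try assumption; try lra.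
  - generalize (filter_and _ _ (filter_and _ _ Hpos (locally_locally _ _ HQ))
      (filter_and _ _ (locally_root_branch a _ ha0 (hD a ha))
                      (locally_root_branch a _ ha0 Hreg))).
    apply filter_imp; intros t [[ht Ht] [hDt [h0 [h1 [hC hB]]]]].
    apply (is_derive_ext_loc (fun t => q_of X Y (root_branch a t))).
    { revert Ht; apply filter_imp; intros u e; symmetry; exact e. }
    apply is_derive_via_root_branch; try assumption.
    rewrite (locally_singleton _ _ Ht).
    generalize (is_derive_q_of n nu D X Y _ hXY hDt h0 h1 hC hB).
    rewrite root_branch_square by assumption; intros H; exact H.
  - apply is_derive_via_root_branch; try assumption.
    rewrite root_branch_at by assumption.
    exact (is_derive_w_of n nu D X Y a hXY ha ha0 ha1 hden hqden hq1 hqb).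
Qed.
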